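(* Let $0<\alpha<1$ and let $f(z)=\sum_{n=0}^\infty a_n z^n$ be a function in the class $\mathcal{B}$. Then $$|a_0|^2\,\frac{r^{-2\alpha}}{\Gamma(1-\alpha)^2} + \sum_{n=1}^\infty \frac{\Gamma(n+1)}{\Gamma(n+1-\alpha)}\,|a_n|\, r^{n-\alpha} \;\le\; \frac{r^{-2\alpha}}{\Gamma(1-\alpha)^2}\qquad\text{for all } 0<r\le N(\alpha),$$ where $N(\alpha)$ is the minimum positive solution $r\in(0,1)$ of $$\sum_{n=1}^\infty \frac{\Gamma(n+1)}{\Gamma(n+1-\alpha)}\, r^{n+\alpha} = \frac{1}{\Gamma(1-\alpha)^2}.$$
   Context: $\mathbb{D}=\{z\in\mathbb{C}:|z|<1\}$. $\mathcal{B}$ denotes the class of analytic functions $f(z)=\sum_{n=0}^\infty a_nz^n$ in $\mathbb{D}$ such that $|f(z)|<1$ for all $z\in\mathbb{D}$. $\Gamma$ is the Gamma function. *)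

(* Defs.v *)
From Stdlib Require Import Reals.
From Coquelicot Require Import Coquelicot.

Open Scope R_scope.

(* Euler's integral of the second kind, convergent exactly for [0 < x]; for
   other [x] the value is junk. *)
Definition Gamma (x : R) : R :=
  RInt_gen (fun t : R => Rpower t (x - 1) * exp (- t))
    (at_right 0) (Rbar_locally p_infty).

Definition unit_disk (z : C) : Prop := Cmod z < 1.

Definition power_series_in_disk (a : nat -> C) (f : C -> C) : Prop :=
  forall z : C, unit_disk z ->
    @is_pseries C_AbsRing C_NormedModule a z (f z).

(* Functions on the disk are total functions [C -> C] whose values off the disk
   are ignored. Analyticity in the disk is expressed by a power series at the
   origin that converges to [f] on the whole disk. *)
Definition class_B (f : C -> C) : Prop :=
  (exists a : nat -> C, power_series_in_disk a f) /\
  (forall z : C, unit_disk z -> Cmod (f z) < 1).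

(* Gamma(n+1) / Gamma(n+1-alpha) *)
Definition gamma_ratio (alpha : R) (n : nat) : R :=
  Gamma (INR n + 1) / Gamma (INR n + 1 - alpha).

(* Series from [n = 1] are written by substituting [S k] for [n]. *)
Definition solves_radius_eq (alpha r : R) : Prop :=
  is_series
    (fun k : nat => gamma_ratio alpha (S k) * Rpower r (INR (S k) + alpha))
    (1 / Gamma (1 - alpha) ^ 2).

Definition is_min_solution (alpha N : R) : Prop :=
  (0 < N < 1 /\ solves_radius_eq alpha N) /\
  (forall r : R, 0 < r < 1 -> solves_radius_eq alpha r -> N <= r).

(* Main.v *)
Require Import Defs.
From Stdlib Require Import Reals Lra Lia Classical.
From Coquelicot Require Import Coquelicot.

Open Scope R_scope.

(* Every f in the class satisfies |a_n| <= 1 - |a_0|^2 for n >= 1, so the sum is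
   at most (1 - |a_0|^2) r^(-2 alpha) F(r), where F is the left-hand side of the
   equation defining N(alpha); F increases from 0 to infinity on (0,1).

   The coefficient bound is the statement that T = [[a_0, 0], [a_n, a_0]] is a
   contraction, tested on the vector c = (1 - |a_0|^2, conj(a_0) a_n), for which
   T c = (a_0 (1 - |a_0|^2), a_n).  Contractivity of T comes from averaging
   pointwise inequalities for c_0 + c_1 u^n over the roots of unity u, after f
   has been replaced by a Taylor polynomial on a circle of radius rho < 1. *)

(** * The coefficient bound *)

Definition Csum (u : nat -> C) (n : nat) : C := sum_n u n.

Lemma Csum_O (u : nat -> C) : Csum u 0 = u 0%nat.
Proof. apply (sum_O u). Qed.

Lemma Csum_S (u : nat -> C) (n : nat) : Csum u (S n) = (Csum u n + u (S n))%C.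
Proof. apply (sum_Sn u). Qed.

Lemma Csum_ext_loc (u v : nat -> C) (n : nat) :
  (forall k, (k <= n)%nat -> u k = v k) -> Csum u n = Csum v n.
Proof. apply (sum_n_ext_loc u v). Qed.

Lemma Csum_ext (u v : nat -> C) (n : nat) :
  (forall k, u k = v k) -> Csum u n = Csum v n.
Proof. intros H. apply Csum_ext_loc. auto. Qed.

Lemma Csum_plus (u v : nat -> C) (n : nat) :
  Csum (fun k => u k + v k)%C n = (Csum u n + Csum v n)%C.
Proof. exact (sum_n_plus u v n). Qed.

Lemma Csum_mult_l (c : C) (u : nat -> C) (n : nat) :
  Csum (fun k => c * u k)%C n = (c * Csum u n)%C.
Proof. exact (sum_n_mult_l (K := C_Ring) c u n). Qed.

Lemma Csum_switch (u : nat -> nat -> C) (m n : nat) :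
  Csum (fun i => Csum (u i) n) m = Csum (fun j => Csum (fun i => u i j) m) n.
Proof. exact (sum_n_switch (G := C_AbelianMonoid) u m n). Qed.

Lemma Csum_conj (u : nat -> C) (n : nat) :
  Csum (fun k => Cconj (u k)) n = Cconj (Csum u n).
Proof.
  induction n as [|n IH]; [now rewrite !Csum_O|].
  rewrite !Csum_S, IH. symmetry. apply Cplus_conj.
Qed.

Lemma Re_Csum_nonneg (u : nat -> C) (n : nat) :
  (forall k, 0 <= Re (u k)) -> 0 <= Re (Csum u n).
Proof.
  intros H. induction n as [|n IH]; [now rewrite Csum_O|].
  rewrite Csum_S. change (0 <= Re (Csum u n) + Re (u (S n))).
  specialize (H (S n)). lra.
Qed.

Lemma Csum_single (u : nat -> C) (i n : nat) :
  (i <= n)%nat -> (forall k, (k <= n)%nat -> k <> i -> u k = 0) ->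
  Csum u n = u i.
Proof.
  induction n as [|n IH]; intros Hi H.
  - rewrite Csum_O. f_equal; lia.
  - rewrite Csum_S.     destruct (Nat.eq_dec i (S n)) as [->|Hn].
    + rewrite (Csum_ext_loc u (fun _ => RtoC 0)).
      2: intros k Hk; apply H; lia.
      assert (E : forall p, Csum (fun _ => RtoC 0) p = 0).
      { intros p. induction p as [|p IHp]; [now rewrite Csum_O|].
        rewrite Csum_S, IHp. apply Cplus_0_l. }
      rewrite E. apply Cplus_0_l.
    + rewrite IH, (H (S n)); try lia. apply Cplus_0_r.
      intros k Hk; apply H; lia.
Qed.

Lemma Csum_geom (z : C) (m : nat) :
  ((z - 1) * Csum (fun j => z ^ j) m)%C = (z ^ S m - 1)%C.
Proof.
  induction m as [|m IH].
  - rewrite Csum_O, Cpow_S. simpl. ring.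
  - rewrite Csum_S. rewrite Cmult_plus_distr_l, IH, (Cpow_S z (S m)). ring.
Qed.

(** * Roots of unity and their power sums *)

Definition cis (t : R) : C := (cos t, sin t).

Lemma cis_plus (s t : R) : cis (s + t) = (cis s * cis t)%C.
Proof.
  unfold cis, Cmult; simpl. rewrite cos_plus, sin_plus. f_equal; ring.
Qed.

Lemma cis_pow (t : R) (n : nat) : (cis t ^ n)%C = cis (INR n * t).
Proof.
  induction n as [|n IH].
  - simpl. unfold cis. now rewrite Rmult_0_l, cos_0, sin_0.
  - rewrite Cpow_S, IH, <- cis_plus, S_INR. f_equal. ring.
Qed.

Lemma Cmod_cis (t : R) : Cmod (cis t) = 1.
Proof.
  unfold Cmod, cis; simpl.
  replace (cos t * (cos t * 1) + sin t * (sin t * 1)) with 1.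
  - apply sqrt_1.
  - generalize (sin2_cos2 t). unfold Rsqr. lra.
Qed.

Lemma cis_2PI_mult (k : nat) : cis (INR k * (2 * PI)) = 1.
Proof.
  rewrite <- cis_pow. unfold cis. rewrite cos_2PI, sin_2PI. apply Cpow_1_l.
Qed.

(** The real part already decides: [cos t = 1 - 2 sin(t/2)^2], and [sin(t/2)] is positive on this
    range. *)
Lemma cis_neq_1 (t : R) : 0 < t < 2 * PI -> cis t <> 1.
Proof.
  intros Ht H. apply (f_equal fst) in H. unfold cis in H; simpl in H.
  replace t with (2 * (t / 2)) in H by field. rewrite cos_2a_sin in H.
  assert (0 < sin (t / 2)) by (apply sin_gt_0; lra). nra.
Qed.

Definition unity_root (M : nat) : C := cis (2 * PI / INR M).

Lemma unity_root_pow_M (M : nat) : (0 < M)%nat -> (unity_root M ^ M)%C = 1.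
Proof.
  intros HM. unfold unity_root. rewrite cis_pow.
  rewrite <- (cis_2PI_mult 1). f_equal. simpl. field.
  apply not_0_INR; lia.
Qed.

Lemma unity_root_pow_neq_1 (M k : nat) :
  (0 < k < M)%nat -> (unity_root M ^ k)%C <> 1.
Proof.
  intros Hk. unfold unity_root. rewrite cis_pow. apply cis_neq_1.
  assert (0 < INR k < INR M) by (split; [apply (lt_INR 0)|apply lt_INR]; lia).
  generalize PI_RGT_0; intros.
  replace (INR k * (2 * PI / INR M)) with (2 * PI * (INR k / INR M)) by (field; lra).
  assert (0 < INR k / INR M < 1).
  { split; [apply Rdiv_lt_0_compat; lra|].
    apply Rmult_lt_reg_r with (INR M); [lra|]. field_simplify; lra. }
  split; nra.
Qed.

Lemma sum_unity_root_pow_M (m : nat) :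
  Csum (fun j => ((unity_root (S m) ^ S m) ^ j)%C) m = INR (S m).
Proof.
  rewrite (Csum_ext _ (fun _ => RtoC 1)).
  2: intros j; rewrite unity_root_pow_M by lia; apply Cpow_1_l.
  generalize m; clear m. intros m. induction m as [|m IH]; [now rewrite Csum_O|].
  rewrite Csum_S, IH, (S_INR (S m)), RtoC_plus. reflexivity.
Qed.

(** This is a geometric sum whose ratio [z] differs from 1 and satisfies [z^(m+1) = 1], so [(z - 1)]
    times the sum vanishes. *)
Lemma sum_unity_root (m k : nat) :
  (0 < k < S m)%nat -> Csum (fun j => ((unity_root (S m) ^ k) ^ j)%C) m = 0.
Proof.
  intros Hk. set (z := (unity_root (S m) ^ k)%C).
  assert (Hz : (z - 1)%C <> 0).
  { intros H. apply (unity_root_pow_neq_1 (S m) k Hk). fold z.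
    replace z with ((z - 1) + 1)%C by ring. rewrite H. ring. }
  generalize (Csum_geom z m).
  replace (z ^ S m)%C with (RtoC 1).
  - intros H. replace (1 - 1)%C with (RtoC 0) in H by ring.
    transitivity (/ (z - 1) * ((z - 1) * Csum (fun j => (z ^ j)%C) m))%C.
    + now field.
    + rewrite H. ring.
  - unfold z. rewrite <- Cpow_mult_r, Nat.mul_comm, Cpow_mult_r.
    rewrite unity_root_pow_M by lia. now rewrite Cpow_1_l.
Qed.

Lemma Cmod_unity_root_pow (M j : nat) : Cmod (unity_root M ^ j) = 1.
Proof. unfold unity_root. now rewrite cis_pow, Cmod_cis. Qed.

(** Both sides are inverse to [z^n], one because [|z^n| = 1], the other because [z^M = 1].
    Conjugates thus become nonnegative powers, which [sum_unity_root_poly] can handle. *)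
Lemma conj_unity_root_pow (M n : nat) :
  (n <= M)%nat -> (0 < M)%nat -> Cconj (unity_root M ^ n) = (unity_root M ^ (M - n))%C.
Proof.
  intros Hn HM. set (z := unity_root M).
  assert (E : (z ^ n * Cconj (z ^ n))%C = 1).
  { rewrite <- Cmod2_conj. unfold z. rewrite Cmod_unity_root_pow. f_equal. ring. }
  assert (F : (z ^ n * z ^ (M - n))%C = 1).
  { rewrite <- Cpow_add_r. replace (n + (M - n))%nat with M by lia.
    now apply unity_root_pow_M. }
  transitivity (z ^ n * z ^ (M - n) * Cconj (z ^ n))%C.
  - rewrite F. ring.
  - transitivity (z ^ (M - n) * (z ^ n * Cconj (z ^ n)))%C; [ring|].
    rewrite E. ring.
Qed.

(** Exchange of the two summations. The inner sum on the right is [m + 1] when [m + 1] divides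
    [k + e] and 0 otherwise, so the average picks out single coefficients. *)
Lemma sum_unity_root_poly (b : nat -> C) (K m e : nat) :
  Csum (fun j => (Csum (fun k => b k * (unity_root (S m) ^ j) ^ k)
                    K * (unity_root (S m) ^ j) ^ e)%C) m =
  Csum (fun k => (b k * Csum (fun j => (unity_root (S m) ^ (k + e)) ^ j) m)%C) K.
Proof.
  set (z := unity_root (S m)).
  rewrite (Csum_ext _ (fun j => Csum (fun k => (b k * (z ^ (k + e)) ^ j)%C) K)).
  - rewrite (Csum_switch
      (fun j k => (b k * (z ^ (k + e)) ^ j)%C)).
    apply Csum_ext. intros k. apply Csum_mult_l.
  - intros j. rewrite Cmult_comm, <- Csum_mult_l. apply Csum_ext. intros k.
    rewrite <- !Cpow_mult_r.
    replace ((k + e) * j)%nat with (j * k + j * e)%nat by ring.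
    rewrite Cpow_add_r. ring.
Qed.

(** * The Toeplitz inequality for polynomials bounded by 1 on the circle *)

Lemma Re_contraction (c d p : C) :
  Cmod p <= 1 ->
  0 <= Re (c * Cconj c + d * Cconj d - 2 * (Cconj d * c * p)).
Proof.
  intros Hp.
  assert (H : Re (c * Cconj c + d * Cconj d - 2 * (Cconj d * c * p)) =
    Cmod c ^ 2 + Cmod d ^ 2 - 2 * Re (Cconj d * c * p)).
  { rewrite !Cmod2_alt. unfold Re, Im, Cconj, Cmult, Cplus, Cminus, Copp; simpl. ring. }
  rewrite H.
  generalize (re_le_Cmod (Cconj d * c * p)).
  rewrite !Cmod_mult, Cmod_conj. intros H1.
  generalize (Rle_abs (Re (Cconj d * c * p))) (Cmod_ge_0 c) (Cmod_ge_0 d); intros.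
  assert (Cmod d * Cmod c * Cmod p <= Cmod d * Cmod c).
  { rewrite <- (Rmult_1_r (Cmod d * Cmod c)) at 2.
    apply Rmult_le_compat_l; nra. }
  (* The chain is [2 Re(conj d * c * p) <= 2 |d| |c| <= |c|^2 + |d|^2]. *)
  generalize (pow2_ge_0 (Cmod c - Cmod d)). nra.
Qed.

(** With [T = [[b_0, 0], [b_n, b_0]]] the expression is [|c|^2 + |d|^2 - 2 <T c, d>], whose real
    part is nonnegative for all [c], [d] when [T] is a contraction. It is the average of
    [Re_contraction] for [c_0 + c_1 u^n] and [d_0 + d_1 u^n] over roots of unity [u]. *)
Lemma Toeplitz_form (b : nat -> C) (K n : nat) (c0 c1 d0 d1 : C) :
  (0 < n <= K)%nat ->
  (forall u, Cmod u = 1 -> Cmod (Csum (fun k => b k * u ^ k)%C K) <= 1) ->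
  0 <= Re (c0 * Cconj c0 + c1 * Cconj c1 + d0 * Cconj d0 + d1 * Cconj d1
    - 2 * ((Cconj d0 * c0 + Cconj d1 * c1) * b 0%nat + Cconj d1 * c0 * b n))%C.
Proof.
  intros Hn Hb.
  (* There are [K + n + 1] roots, enough to prevent aliasing: for [k <= K], the only multiples of
     [K + n + 1] among the exponents [k], [k + n] and [k + (m + 1 - n)] come from [k = 0] in the
     first family and [k = n] in the third. *)
  set (m := (K + n)%nat). set (z := unity_root (S m)).
  set (P := fun j => Csum (fun k => b k * (z ^ j) ^ k)%C K).
  set (u := fun j => ((z ^ j) ^ n)%C).
  set (q0 := (c0 * Cconj c0 + c1 * Cconj c1 + d0 * Cconj d0 + d1 * Cconj d1)%C).
  set (q1 := (c1 * Cconj c0 + d1 * Cconj d0)%C).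
  set (q2 := (c0 * Cconj c1 + d0 * Cconj d1)%C).
  assert (Hu : forall j, (u j * Cconj (u j))%C = 1).
  { intros j. rewrite <- Cmod2_conj. unfold u, z.
    rewrite <- !Cpow_mult_r, Cmod_unity_root_pow. f_equal. ring. }
  assert (E0 : Csum P m = (INR (S m) * b 0%nat)%C).
  { rewrite (Csum_ext _ (fun j => (P j * (z ^ j) ^ 0)%C)) by (intros; simpl; ring).
    unfold P. unfold z at 1 2. rewrite sum_unity_root_poly.
    rewrite (Csum_single _ 0).
    - simpl (0 + 0)%nat. rewrite (Csum_ext _ (fun j => ((z ^ S m) ^ j)%C)).
      + unfold z. rewrite sum_unity_root_pow_M. ring.
      + intros j. unfold z. rewrite unity_root_pow_M by lia. reflexivity.
    - lia.
    - intros k Hk1 Hk2. rewrite sum_unity_root by lia. ring. }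
  assert (E1 : Csum (fun j => (P j * u j)%C) m = 0).
  { unfold P, u. unfold z at 1 2. rewrite sum_unity_root_poly.
    (* No index survives here: the sum is reduced to its term at 0, and that term vanishes like the
       others. *)
    rewrite (Csum_single _ 0); [|lia|];
    intros; rewrite sum_unity_root by lia; ring. }
  assert (Ec : forall j, Cconj (u j) = ((z ^ j) ^ (S m - n))%C).
  { intros j. unfold u, z. rewrite <- !Cpow_mult_r, (Nat.mul_comm j n),
      Cpow_mult_r, Cpow_conj, conj_unity_root_pow by lia.
    now rewrite <- Cpow_mult_r, Nat.mul_comm. }
  assert (E2 : Csum (fun j => (P j * Cconj (u j))%C) m = (INR (S m) * b n)%C).
  { rewrite (Csum_ext _ (fun j => (P j * (z ^ j) ^ (S m - n))%C))
      by (intros; now rewrite Ec).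
    unfold P. unfold z at 1 2. rewrite sum_unity_root_poly.
    rewrite (Csum_single _ n).
    - replace (n + (S m - n))%nat with (S m) by lia.
      rewrite sum_unity_root_pow_M. ring.
    - lia.
    - intros k Hk1 Hk2. destruct (Nat.le_gt_cases (S m) (k + (S m - n))) as [H|H].
      + rewrite (Csum_ext _ (fun j => ((unity_root (S m) ^ (k - n)) ^ j)%C)).
        * rewrite sum_unity_root by lia. ring.
        * intros j. f_equal. replace (k + (S m - n))%nat with (S m + (k - n))%nat by lia.
          rewrite Cpow_add_r, unity_root_pow_M by lia. ring.
      + rewrite sum_unity_root by lia. ring. }
  assert (Eu : Csum u m = 0).
  { rewrite (Csum_ext _ (fun j => ((unity_root (S m) ^ n) ^ j)%C)).
    - apply sum_unity_root; lia.
    - intros j. unfold u, z. rewrite <- !Cpow_mult_r. f_equal; lia. }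
  assert (Ecu : Csum (fun j => Cconj (u j)) m = 0).
  { rewrite Csum_conj, Eu. unfold Cconj. simpl. unfold RtoC. f_equal. ring. }
  assert (E3 : Csum (fun _ => RtoC 1) m = RtoC (INR (S m))).
  { rewrite <- sum_unity_root_pow_M. apply Csum_ext. intros j.
    rewrite unity_root_pow_M by lia. now rewrite Cpow_1_l. }
  set (c := fun j => (c0 + c1 * u j)%C). set (d := fun j => (d0 + d1 * u j)%C).
  assert (HS := Re_Csum_nonneg (fun j => c j * Cconj (c j) + d j * Cconj (d j)
     - 2 * (Cconj (d j) * c j * P j))%C m).
  (* The summand as a trigonometric polynomial in [u j], using [u j * Cconj (u j) = 1]. *)
  rewrite (Csum_ext _ (fun j => q0 * 1 + (q1 * u j + (q2 * Cconj (u j) +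
    (-2 * (Cconj d0 * c0 + Cconj d1 * c1) * P j
     + (-2 * Cconj d0 * c1 * (P j * u j)
        + -2 * Cconj d1 * c0 * (P j * Cconj (u j)))))))%C) in HS.
  2: { intros j. unfold c, d, q0, q1, q2. rewrite !Cplus_conj, !Cmult_conj.
    set (v := Cconj (u j)).
    (* The two sides agree as polynomials in [u j] and [v] only modulo [1 - u j * v]; the right
       multiple of it is subtracted so that [ring] applies. *)
    match goal with |- _ = ?r => replace r with
     (r - (c1 * Cconj c1 + d1 * Cconj d1 - 2 * Cconj d1 * c1 * P j) * (1 - u j * v))%C
    end.
    - ring.
    - unfold v; rewrite (Hu j). ring. }
  rewrite !Csum_plus, !Csum_mult_l, E0, E1, E2, E3, Eu, Ecu in HS.
  assert (HI : 0 < INR (S m)) by apply lt_0_INR, Nat.lt_0_succ.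
  apply Rmult_le_reg_l with (INR (S m)); [exact HI|]. rewrite Rmult_0_r.
  assert (HS' : 0 <= Re (INR (S m) * (q0 - 2 * ((Cconj d0 * c0 + Cconj d1 * c1) * b 0%nat
     + Cconj d1 * c0 * b n)))%C).
  { match type of HS with _ -> 0 <= Re ?x => match goal with |- 0 <= Re ?y =>
      replace y with x by ring end end.
    apply HS. intros j. apply Re_contraction, Hb.
    unfold z. apply Cmod_unity_root_pow. }
  match goal with |- 0 <= _ * Re ?y => replace (INR (S m) * Re y) with
    (Re (INR (S m) * y)%C) end.
  - exact HS'.
  - unfold Re; simpl. ring.
Qed.

(** Choosing [d = T c] turns the form into [|c|^2 - |T c|^2], which for the chosen [c] factors as
    [(1 - A^2) ((1 - A^2)^2 - B^2)]. The strict bound on [b_0] allows the first factor to be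
    cancelled. *)
Lemma poly_coef_bound (b : nat -> C) (K n : nat) :
  (0 < n <= K)%nat -> Cmod (b 0%nat) < 1 ->
  (forall u, Cmod u = 1 -> Cmod (Csum (fun k => b k * u ^ k)%C K) <= 1) ->
  Cmod (b n) <= 1 - Cmod (b 0%nat) ^ 2.
Proof.
  intros Hn H0 Hb.
  set (A := Cmod (b 0%nat)) in *. set (B := Cmod (b n)).
  assert (HA : 0 <= A) by apply Cmod_ge_0.
  assert (HB : 0 <= B) by apply Cmod_ge_0.
  assert (H := Toeplitz_form b K n (1 - A ^ 2)%R (Cconj (b 0%nat) * b n)%C
    (b 0%nat * (1 - A ^ 2)%R)%C (b n) Hn Hb).
  match type of H with 0 <= Re ?x => replace (Re x) with
   ((1 - A ^ 2) ^ 2 + A ^ 2 * B ^ 2 - A ^ 2 * (1 - A ^ 2) ^ 2 - B ^ 2) in H end.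
  - assert (0 < 1 - A ^ 2) by nra.
    assert (B ^ 2 <= (1 - A ^ 2) ^ 2).
    { apply Rmult_le_reg_l with (1 - A ^ 2); nra. }
    apply Rsqr_incr_0; unfold Rsqr; nra.
  - unfold A, B. rewrite !Cmod2_alt.
    destruct (b 0%nat) as [x y], (b n) as [s t]. unfold Re, Im; simpl. ring.
Qed.

(** * From power series on the disk to polynomials on a circle *)

Lemma power_series_Csum_lim (a : nat -> C) (f : C -> C) (z : C) :
  power_series_in_disk a f -> unit_disk z ->
  filterlim (fun K => Csum (fun k => a k * z ^ k)%C K) eventually
    (@locally C_NormedModule (f z)).
Proof.
  intros Ha Hz. generalize (Ha z Hz).
  apply filterlim_ext. intros K. apply Csum_ext. intros k.
  assert (E : @pow_n C_AbsRing z k = (z ^ k)%C).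
  { induction k as [|k IH]; [reflexivity|]. simpl. now rewrite IH. }
  rewrite E. apply Cmult_comm.
Qed.

(** Convergence at the point [s] bounds the partial sums by some [M]; a term is a difference of two
    consecutive partial sums, whence [2 M]. *)
Lemma power_series_coef_geom (a : nat -> C) (f : C -> C) (s : R) :
  power_series_in_disk a f -> 0 < s < 1 ->
  exists B, 0 <= B /\ forall k, Cmod (a k) * s ^ k <= B.
Proof.
  intros Ha Hs.
  assert (Hz : unit_disk s) by (unfold unit_disk; rewrite Cmod_R, Rabs_pos_eq; lra).
  assert (H := power_series_Csum_lim a f s Ha Hz).
  destruct (filterlim_bounded (K := C_AbsRing) (V := C_NormedModule) _
    (ex_intro (fun x : C_NormedModule => filterlim _ eventually (locally x)) _ H)) as [M HM].
  assert (HM' : forall K, Cmod (Csum (fun k => a k * s ^ k)%C K) <= M) by exact HM.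
  clear HM H. exists (2 * M).
  assert (0 <= M) by (eapply Rle_trans; [apply Cmod_ge_0|apply (HM' 0%nat)]).
  split; [lra|]. intros k.
  replace (Cmod (a k) * s ^ k) with (Cmod (a k * s ^ k)).
  2: now rewrite Cmod_mult, Cmod_pow, Cmod_R, Rabs_pos_eq by lra.
  destruct k as [|k].
  - specialize (HM' 0%nat). rewrite Csum_O in HM'. lra.
  - replace (a (S k) * s ^ S k)%C with (Csum (fun k => a k * s ^ k)%C (S k)
      + - Csum (fun k => a k * s ^ k)%C k)%C by (rewrite Csum_S; ring).
    eapply Rle_trans; [apply Cmod_triangle|]. rewrite Cmod_opp.
    generalize (HM' (S k)) (HM' k). lra.
Qed.

Lemma Cmod_Csum_diff_geom (u : nat -> C) (B t : R) (K j : nat) :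
  0 <= B -> 0 <= t < 1 -> (forall k, Cmod (u k) <= B * t ^ k) ->
  Cmod (Csum u (K + j) - Csum u K) <= B / (1 - t) * t ^ K.
Proof.
  intros HB Ht Hu.
  assert (Hp : forall k, 0 <= t ^ k) by (intros; apply pow_le; lra).
  assert (HB' : 0 <= B / (1 - t)) by (apply Rdiv_le_0_compat; lra).
  (* The sharper bound with [t^K - t^(K+j)] is what induction on [j] can carry: its increment
     absorbs the next term. *)
  cut (Cmod (Csum u (K + j) - Csum u K) <= B / (1 - t) * (t ^ K - t ^ (K + j))).
  { generalize (Hp (K + j)%nat). nra. }
  induction j as [|j IH].
  - rewrite Nat.add_0_r. replace (Csum u K - Csum u K)%C with (RtoC 0) by ring.
    rewrite Cmod_0. lra.
  - rewrite <- plus_n_Sm, Csum_S.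
    replace (Csum u (K + j) + u (S (K + j)) - Csum u K)%C with
      ((Csum u (K + j) - Csum u K) + u (S (K + j)))%C by ring.
    eapply Rle_trans; [apply Cmod_triangle|].
    eapply Rle_trans; [apply Rplus_le_compat; [exact IH|apply Hu]|].
    simpl (t ^ S (K + j)). generalize (Hp (K + j)%nat). intros.
    replace (B * (t * t ^ (K + j))) with (B / (1 - t) * ((1 - t) * (t * t ^ (K + j))))
      by (field; lra).
    rewrite <- Rmult_plus_distr_l. apply Rmult_le_compat_l; [exact HB'|].
    assert (0 <= (1 - t) * ((1 - t) * t ^ (K + j))) by (repeat apply Rmult_le_pos; lra).
    nra.
Qed.

(** Uniformity in [z] comes from a point [s] strictly between [rho] and 1: the coefficient bound at
    [s] dominates all terms on the circle by [B (rho/s)^k]. *)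
Lemma power_series_tail (a : nat -> C) (f : C -> C) (rho eps : R) :
  power_series_in_disk a f -> 0 < rho < 1 -> 0 < eps ->
  exists K0, forall K z, (K0 <= K)%nat -> Cmod z = rho ->
    Cmod (f z - Csum (fun k => a k * z ^ k)%C K) <= eps.
Proof.
  intros Ha Hr He. set (s := (1 + rho) / 2). set (t := rho / s).
  assert (Hs : 0 < s < 1) by (unfold s; lra).
  assert (Hrs : rho < s) by (unfold s; lra).
  assert (Ht : 0 < t < 1).
  { unfold t. split; [apply Rdiv_lt_0_compat; lra|].
    apply Rmult_lt_reg_r with s; [lra|]. field_simplify; lra. }
  destruct (power_series_coef_geom a f s Ha Hs) as [B [HB HBk]].
  assert (HD : 0 <= B / (1 - t)) by (apply Rdiv_le_0_compat; lra).
  (* The added 1 keeps the denominator positive when [B = 0]. *)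
  destruct (pow_lt_1_zero t) with (y := eps / 2 / (B / (1 - t) + 1)) as [K0 HK0].
  { rewrite Rabs_pos_eq; lra. }
  { apply Rdiv_lt_0_compat; lra. }
  exists K0. intros K z HK Hz.
  set (u := fun k => (a k * z ^ k)%C).
  assert (Hu : forall k, Cmod (u k) <= B * t ^ k).
  { intros k. unfold u. rewrite Cmod_mult, Cmod_pow, Hz.
    replace rho with (t * s) by (unfold t; field; lra). rewrite Rpow_mult_distr.
    generalize (HBk k) (pow_le t k). nra. }
  assert (HKt : B / (1 - t) * t ^ K <= eps / 2).
  { specialize (HK0 K HK). rewrite Rabs_pos_eq in HK0 by (apply pow_le; lra).
    assert (HK1 : (B / (1 - t) + 1) * t ^ K <= eps / 2).
    { apply Rmult_lt_compat_l with (r := B / (1 - t) + 1) in HK0; [|lra].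
      replace ((B / (1 - t) + 1) * (eps / 2 / (B / (1 - t) + 1))) with (eps / 2) in HK0.
      - lra.
      - field. split; lra. }
    generalize (pow_le t K). lra. }
  assert (Hd : unit_disk z) by (unfold unit_disk; lra).
  assert (HL := power_series_Csum_lim a f z Ha Hd).
  assert (He2 : 0 < eps / 2) by lra.
  apply (filterlim_locally_ball_norm (K := C_AbsRing) (U := C_NormedModule)) with
    (eps := mkposreal _ He2) in HL.
  destruct HL as [N HN]. specialize (HN (K + N)%nat ltac:(lia)).
  change (Cmod (Csum u (K + N) - f z) < eps / 2) in HN.
  replace (f z - Csum u K)%C with
    (- (Csum u (K + N) - f z) + (Csum u (K + N) - Csum u K))%C by ring.
  eapply Rle_trans; [apply Cmod_triangle|]. rewrite Cmod_opp.
  generalize (Cmod_Csum_diff_geom u B t K N HB ltac:(lra) Hu). lra.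
Qed.

Lemma power_series_at_0 (a : nat -> C) (f : C -> C) :
  power_series_in_disk a f -> f 0 = a 0%nat.
Proof.
  intros Ha. assert (H0 : unit_disk 0) by (unfold unit_disk; rewrite Cmod_0; lra).
  exact (filterlim_locally_unique (K := C_AbsRing) (V := C_NormedModule) _ _ _
    (Ha 0 H0) (is_pseries_0 (K := C_AbsRing) a)).
Qed.

Lemma bernoulli_one_minus (d : R) (n : nat) : 0 <= d <= 1 -> 1 - INR n * d <= (1 - d) ^ n.
Proof.
  intros Hd. induction n as [|n IH]; [simpl; lra|].
  rewrite S_INR. simpl. generalize (pos_INR n). intros.
  assert (0 <= INR n * d) by nra. nra.
Qed.

(** On the circle of radius [rho] a partial sum has modulus at most [1 + eps]. Divided by [1 + eps],
    it satisfies the hypothesis of [poly_coef_bound]; then [eps] tends to 0 and [rho] to 1. *)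
Lemma class_B_coef_bound (f : C -> C) (a : nat -> C) (n : nat) :
  class_B f -> power_series_in_disk a f -> (0 < n)%nat ->
  Cmod (a n) <= 1 - Cmod (a 0%nat) ^ 2.
Proof.
  intros [_ Hf] Ha Hn.
  assert (H0 : Cmod (a 0%nat) < 1).
  { rewrite <- (power_series_at_0 a f Ha). apply Hf.
    unfold unit_disk; rewrite Cmod_0; lra. }
  set (A := Cmod (a 0%nat)) in *. set (B := Cmod (a n)).
  assert (HA : 0 <= A) by apply Cmod_ge_0.
  assert (HB : 0 <= B) by apply Cmod_ge_0.
  assert (Hrho : forall rho, 0 < rho < 1 -> B * rho ^ n <= 1 - A ^ 2).
  { intros rho Hr. apply le_epsilon. intros e He.
    set (eps := e / 2). assert (Heps : 0 < eps) by (unfold eps; lra).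
    destruct (power_series_tail a f rho eps Ha Hr Heps) as [K0 HK0].
    set (K := (K0 + n)%nat).
    assert (Hinv : 0 < / (1 + eps)) by (apply Rinv_0_lt_compat; lra).
    assert (Hinv1 : / (1 + eps) <= 1).
    { rewrite <- Rinv_1. apply Rinv_le_contravar; lra. }
    assert (Hm : forall k, Cmod (a k * rho ^ k * (/ (1 + eps))%R)%C =
      Cmod (a k) * rho ^ k * / (1 + eps)).
    { intros k. rewrite !Cmod_mult, Cmod_pow, !Cmod_R, !Rabs_pos_eq; lra. }
    generalize (poly_coef_bound (fun k => a k * rho ^ k * (/ (1 + eps))%R)%C K n).
    rewrite !Hm. fold A B. rewrite pow_O, Rmult_1_r. intros HP.
    assert (HP1 : B * rho ^ n * / (1 + eps) <= 1 - (A * / (1 + eps)) ^ 2).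
    { apply HP; [unfold K; lia|nra|]. intros u Hu.
      rewrite (Csum_ext _ (fun k => (/ (1 + eps))%R * (a k * (rho * u) ^ k))%C).
      2: intros k; rewrite Cpow_mult_l; ring.
      rewrite Csum_mult_l, Cmod_mult, Cmod_R, Rabs_pos_eq by lra.
      assert (Hz : Cmod (rho * u) = rho).
      { rewrite Cmod_mult, Hu, Cmod_R, Rabs_pos_eq; lra. }
      generalize (HK0 K (rho * u)%C ltac:(unfold K; lia) Hz)
        (Hf (rho * u)%C ltac:(unfold unit_disk; lra)).
      set (S := Csum _ K). set (w := f _). intros H1 H2.
      assert (H3 : Cmod S <= 1 + eps).
      { replace S with (w + - (w - S))%C by ring.
        eapply Rle_trans; [apply Cmod_triangle|]. rewrite Cmod_opp. lra. }
      apply Rmult_le_reg_l with (1 + eps); [lra|].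
      rewrite <- Rmult_assoc, Rinv_r; lra. }
    apply Rmult_le_compat_l with (r := 1 + eps) in HP1; [|lra].
    replace ((1 + eps) * (B * rho ^ n * / (1 + eps))) with (B * rho ^ n) in HP1
      by (field; lra).
    replace ((1 + eps) * (1 - (A * / (1 + eps)) ^ 2)) with
      (1 + eps - A ^ 2 * / (1 + eps)) in HP1 by (field; lra).
    (* The right-hand side is now at most [1 + eps - A^2 (1 - eps)], which exceeds [1 - A^2] by at
       most [2 eps = e]. *)
    assert (1 - eps <= / (1 + eps)).
    { apply Rmult_le_reg_l with (1 + eps); [lra|]. rewrite Rinv_r by lra. nra. }
    assert (A ^ 2 <= 1) by nra. assert (0 <= A ^ 2) by nra.
    assert (A ^ 2 * (1 - eps) <= A ^ 2 * / (1 + eps)) by (apply Rmult_le_compat_l; lra).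
    assert (A ^ 2 * eps <= eps) by nra.
    replace e with (2 * eps) by (unfold eps; field). lra. }
  apply le_epsilon. intros e He.
  assert (HnB : 0 <= B * INR n) by (apply Rmult_le_pos; [exact HB|apply pos_INR]).
  (* With [rho = 1 - d], Bernoulli's inequality costs at most [B n d <= e]; the cap 1/2 keeps [rho]
     inside (0,1). *)
  set (d := Rmin (1 / 2) (e / (B * INR n + 1))).
  assert (Hd : 0 < d <= 1 / 2).
  { unfold d. split; [apply Rmin_glb_lt; [lra|apply Rdiv_lt_0_compat; lra]|apply Rmin_l]. }
  assert (Hd2 : (B * INR n + 1) * d <= e).
  { replace e with ((B * INR n + 1) * (e / (B * INR n + 1))) by (field; lra).
    apply Rmult_le_compat_l; [lra|apply Rmin_r]. }
  generalize (Hrho (1 - d) ltac:(lra)) (bernoulli_one_minus d n ltac:(lra)). nra.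
Qed.

(** * The Gamma integral *)

Definition Gamma_integrand (x t : R) : R := Rpower t (x - 1) * exp (- t).

Lemma Gamma_integrand_pos (x t : R) : 0 < Gamma_integrand x t.
Proof. apply Rmult_lt_0_compat; apply exp_pos. Qed.

Lemma Gamma_integrand_S (x t : R) :
  0 < t -> Gamma_integrand (x + 1) t = t * Gamma_integrand x t.
Proof.
  intros Ht. unfold Gamma_integrand.
  replace (x + 1 - 1) with (1 + (x - 1)) by ring.
  rewrite Rpower_plus, Rpower_1 by exact Ht. ring.
Qed.

(** Expressing the derivative through integrands themselves serves twice: for the bound on the
    integrals and for integration by parts in the functional equation. *)
Lemma is_derive_Gamma_integrand (x t : R) :
  0 < t ->
  is_derive (Gamma_integrand (x + 1)) t
    (x * Gamma_integrand x t - Gamma_integrand (x + 1) t).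
Proof.
  intros Ht. replace (x * Gamma_integrand x t) with
    (x * / t * Gamma_integrand (x + 1) t).
  - unfold Gamma_integrand, Rpower. auto_derive; [exact Ht|]. field. lra.
  - rewrite Gamma_integrand_S by exact Ht. field. lra.
Qed.

Lemma continuous_Gamma_integrand (x t : R) :
  0 < t -> continuous (Gamma_integrand x) t.
Proof.
  intros Ht. replace x with (x - 1 + 1) by ring.
  apply (ex_derive_continuous (K := R_AbsRing) (V := R_NormedModule)).
  eexists. now apply is_derive_Gamma_integrand.
Qed.

Lemma ex_RInt_Gamma_integrand (x a b : R) :
  0 < a -> 0 < b -> ex_RInt (Gamma_integrand x) a b.
Proof.
  intros Ha Hb. apply (ex_RInt_continuous (V := R_CompleteNormedModule)).
  intros t Ht. apply continuous_Gamma_integrand.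
  apply Rlt_le_trans with (2 := proj1 Ht). now apply Rmin_glb_lt.
Qed.

(** Apply [ln y <= y] at [y = t/(2x)]; the scale [2x] makes [x ln t] cost only half of the exponent
    [t]. The constant is [(2x)^x]. *)
Lemma Gamma_integrand_decay (x : R) :
  0 < x -> exists K, 0 < K /\
  forall t, 0 < t -> Gamma_integrand (x + 1) t <= K * exp (- t / 2).
Proof.
  intros Hx. exists (exp (x * ln (2 * x))). split; [apply exp_pos|].
  intros t Ht. unfold Gamma_integrand, Rpower. rewrite <- !exp_plus.
  assert (H : ln t <= t / (2 * x) + ln (2 * x)).
  { replace t with (t / (2 * x) * (2 * x)) at 1 by (field; lra).
    assert (0 < t / (2 * x)) by (apply Rdiv_lt_0_compat; lra).
    rewrite ln_mult by lra. apply Rplus_le_compat_r.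
    rewrite <- (ln_exp (t / (2 * x))) at 2. apply ln_le; [lra|].
    generalize (exp_ineq1_le (t / (2 * x))). lra. }
  assert (H2 : (x + 1 - 1) * ln t + - t <= x * ln (2 * x) + - t / 2).
  { apply Rmult_le_compat_l with (r := x) in H; [|lra].
    replace (x * (t / (2 * x) + ln (2 * x))) with (t / 2 + x * ln (2 * x)) in H
      by (field; lra). lra. }
  destruct H2 as [H2|H2]; [left; now apply exp_increasing|right; now rewrite H2].
Qed.

Lemma RInt_Gamma_integrand_bound (x : R) :
  0 < x -> exists L, forall a b, 0 < a <= b -> RInt (Gamma_integrand x) a b <= L.
Proof.
  intros Hx. destruct (Gamma_integrand_decay x Hx) as [K [HK HD]].
  (* [h]'s derivative dominates the integrand, and [h] is bounded on (0, oo). *)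
  set (h := fun t => / x * Gamma_integrand (x + 1) t - 2 * K / x * exp (- t / 2)).
  exists (K / x + 2 * K / x). intros a b Hab.
  assert (HKx : 0 < K / x) by (apply Rdiv_lt_0_compat; lra).
  set (dh := fun t => Gamma_integrand x t - / x * Gamma_integrand (x + 1) t
               + K / x * exp (- t / 2)).
  assert (Hdh : forall t, 0 < t -> is_derive h t (dh t)).
  { intros t Ht. unfold h, dh.
    replace (Gamma_integrand x t - / x * Gamma_integrand (x + 1) t
               + K / x * exp (- t / 2)) with
      (/ x * (x * Gamma_integrand x t - Gamma_integrand (x + 1) t)
        - (- (K / x) * exp (- t / 2))) by (field; lra).
    apply (is_derive_minus (K := R_AbsRing) (V := R_NormedModule)).
    - apply is_derive_scal. now apply is_derive_Gamma_integrand.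
    - auto_derive; [easy|]. unfold Rdiv. field. lra. }
  assert (Hc : forall t, 0 < t -> continuous dh t).
  { intros t Ht. apply (continuous_plus (V := R_NormedModule)).
    - apply (continuous_minus (V := R_NormedModule)).
      + now apply continuous_Gamma_integrand.
      + apply (continuous_scal_r (V := R_NormedModule)).
        now apply continuous_Gamma_integrand.
    - apply (ex_derive_continuous (K := R_AbsRing) (V := R_NormedModule)).
      auto_derive. easy. }
  assert (HI : is_RInt dh a b (h b - h a)).
  { apply (is_RInt_derive (V := R_CompleteNormedModule));
      rewrite Rmin_left, Rmax_right by lra; intros t Ht;
      [apply Hdh|apply Hc]; lra. }
  assert (Hle : RInt (Gamma_integrand x) a b <= RInt dh a b).
  { apply RInt_le; [lra|apply ex_RInt_Gamma_integrand; lra|exists (h b - h a); exact HI|].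
    intros t Ht. unfold dh.
    assert (Gamma_integrand (x + 1) t <= K * exp (- t / 2)) by (apply HD; lra).
    assert (/ x * Gamma_integrand (x + 1) t <= / x * (K * exp (- t / 2))).
    { apply Rmult_le_compat_l; [left; now apply Rinv_0_lt_compat|easy]. }
    unfold Rdiv. lra. }
  rewrite (is_RInt_unique _ _ _ _ HI) in Hle.
  eapply Rle_trans; [exact Hle|].
  assert (He : forall t, 0 < t -> 0 < exp (- t / 2) <= 1).
  { intros t Ht. split; [apply exp_pos|]. rewrite <- exp_0. left.
    apply exp_increasing. lra. }
  assert (Hxi : 0 < / x) by now apply Rinv_0_lt_compat.
  assert (Hb : h b <= K / x).
  { unfold h. assert (Gamma_integrand (x + 1) b <= K * 1).
    { eapply Rle_trans; [apply HD; lra|]. apply Rmult_le_compat_l; [lra|].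
      apply He; lra. }
    assert (/ x * Gamma_integrand (x + 1) b <= K / x).
    { unfold Rdiv. rewrite (Rmult_comm K). apply Rmult_le_compat_l; lra. }
    assert (0 <= 2 * K / x * exp (- b / 2)).
    { apply Rmult_le_pos; [unfold Rdiv in *; nra|left; apply exp_pos]. }
    lra. }
  assert (Ha : - (2 * K / x) <= h a).
  { unfold h. assert (0 < / x * Gamma_integrand (x + 1) a).
    { apply Rmult_lt_0_compat; [easy|apply Gamma_integrand_pos]. }
    assert (2 * K / x * exp (- a / 2) <= 2 * K / x * 1).
    { apply Rmult_le_compat_l; [unfold Rdiv in *; nra|]. apply He; lra. }
    lra. }
  lra.
Qed.

(** The integrals grow with the interval, so their supremum is the improper integral; the interval
    [1,2] already makes it positive. *)
Lemma is_RInt_gen_nonneg_bounded (g : R -> R) (L : R) :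
  (forall t, 0 < t -> 0 < g t) -> (forall t, 0 < t -> continuous g t) ->
  (forall a b, 0 < a <= b -> RInt g a b <= L) ->
  exists l, 0 < l /\ is_RInt_gen g (at_right 0) (Rbar_locally p_infty) l.
Proof.
  intros Hpos Hc HL.
  assert (Hex : forall a b, 0 < a <= b -> ex_RInt g a b).
  { intros a b Hab. apply (ex_RInt_continuous (V := R_CompleteNormedModule)).
    rewrite Rmin_left, Rmax_right by lra. intros t Ht. apply Hc. lra. }
  destruct (completeness (fun y => exists a b, 0 < a <= b /\ y = RInt g a b)) as [l [Hub Hl]].
  { exists L. intros y [a [b [Hab ->]]]. auto. }
  { exists (RInt g 1 1), 1, 1. split; [lra|easy]. }
  exists l. split.
  - apply Rlt_le_trans with (RInt g 1 2).
    + apply RInt_gt_0; [lra| |]; intros t Ht; [apply Hpos|apply Hc]; lra.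
    + apply Hub. exists 1, 2. split; [lra|easy].
  - apply (filterlimi_locally (U := R_UniformSpace)). intros eps.
    assert (exists a b, 0 < a <= b /\ l - eps < RInt g a b) as [a0 [b0 [H0 Hlt]]].
    { destruct (classic
        (exists a b, 0 < a <= b /\ l - eps < RInt g a b)) as [H|H]; [easy|].
      exfalso. assert (l <= l - eps).
      { apply Hl. intros y [a [b [Hab ->]]]. apply Rnot_lt_le. intros Hlt.
        apply H. now exists a, b. }
      generalize (cond_pos eps). lra. }
    (* Any interval containing [[a0, b0]] has an integral between that over [[a0, b0]] and the
       supremum. *)
    exists (fun a => 0 < a < a0) (fun b => b0 < b).
    + exists (mkposreal a0 (proj1 H0)). intros y Hy Hy0. split; [easy|].
      change (Rabs (y - 0) < a0) in Hy. rewrite Rminus_0_r, Rabs_pos_eq in Hy; lra.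
    + exists b0. auto.
    + intros a b Ha Hb. exists (RInt g a b). split.
      * apply (RInt_correct (V := R_CompleteNormedModule)). apply Hex; simpl; lra.
      * assert (H1 : RInt g a b <= l) by (apply Hub; exists a, b; split; [lra|easy]).
        assert (H2 : RInt g a0 b0 <= RInt g a b).
        { rewrite <- (RInt_Chasles g a a0 b), <- (RInt_Chasles g a0 b0 b)
            by (apply Hex; lra).
          assert (forall p q, 0 < p <= q -> 0 <= RInt g p q).
          { intros p q Hpq. apply RInt_ge_0; [lra|now apply Hex|].
            intros t Ht. left. apply Hpos. lra. }
          assert (0 <= RInt g a a0) by (apply H; lra).
          assert (0 <= RInt g b0 b) by (apply H; lra).
          unfold plus; simpl. lra. }
        change (Rabs (RInt g a b - l) < eps). apply Rabs_def1; lra.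
Qed.

(** [Gamma] is a total function; this certifies that for [0 < x] its value is the limit of the
    integrals and not a default. *)
Lemma Gamma_correct (x : R) :
  0 < x -> 0 < Gamma x /\
  is_RInt_gen (Gamma_integrand x) (at_right 0) (Rbar_locally p_infty) (Gamma x).
Proof.
  intros Hx. destruct (RInt_Gamma_integrand_bound x Hx) as [L HL].
  destruct (is_RInt_gen_nonneg_bounded (Gamma_integrand x) L) as [l [Hl HI]].
  - intros; apply Gamma_integrand_pos.
  - intros; now apply continuous_Gamma_integrand.
  - exact HL.
  - assert (E : Gamma x = l) by exact (is_RInt_gen_unique _ _ HI).
    now rewrite E.
Qed.

(** * Boundary limits and the functional equation of Gamma *)

Lemma Gamma_integrand_lim_0 (x : R) :
  0 < x -> filterlim (Gamma_integrand (x + 1)) (at_right 0) (locally 0).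
Proof.
  intros Hx. apply (filterlim_locally (U := R_UniformSpace)). intros eps.
  (* This radius is [eps^(1/x)], below which [t^x < eps]. *)
  assert (Hd : 0 < exp (ln eps / x)) by apply exp_pos.
  exists (mkposreal _ Hd). intros t Ht Ht0.
  change (Rabs (t - 0) < exp (ln eps / x)) in Ht.
  rewrite Rminus_0_r, Rabs_pos_eq in Ht by lra.
  change (Rabs (Gamma_integrand (x + 1) t - 0) < eps).
  generalize (Gamma_integrand_pos (x + 1) t). intros.
  rewrite Rminus_0_r, Rabs_pos_eq by lra.
  assert (exp (- t) <= 1).
  { rewrite <- exp_0. left. apply exp_increasing. lra. }
  assert (H1 : Rpower t (x + 1 - 1) < eps).
  { unfold Rpower. rewrite <- (exp_ln eps) by apply cond_pos.
    apply exp_increasing. apply ln_increasing in Ht; [|lra].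
    rewrite ln_exp in Ht. apply Rmult_lt_compat_l with (r := x) in Ht; [|lra].
    replace (x * (ln eps / x)) with (ln eps) in Ht by (field; lra). lra. }
  unfold Gamma_integrand.
  assert (0 < Rpower t (x + 1 - 1)) by apply exp_pos. nra.
Qed.

Lemma Gamma_integrand_lim_infty (x : R) :
  0 < x -> filterlim (Gamma_integrand (x + 1)) (Rbar_locally p_infty) (locally 0).
Proof.
  intros Hx. destruct (Gamma_integrand_decay x Hx) as [K [HK HD]].
  apply (filterlim_locally (U := R_UniformSpace)). intros eps.
  (* The second entry solves [K exp(-t/2) = eps]; the first keeps [t] positive. *)
  exists (Rmax 1 (- 2 * ln (eps / K))). intros t Ht.
  assert (1 < t) by (apply Rle_lt_trans with (2 := Ht), Rmax_l).
  assert (H1 : - 2 * ln (eps / K) < t) by (apply Rle_lt_trans with (2 := Ht), Rmax_r).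
  change (Rabs (Gamma_integrand (x + 1) t - 0) < eps).
  generalize (Gamma_integrand_pos (x + 1) t). intros.
  rewrite Rminus_0_r, Rabs_pos_eq by lra.
  apply Rle_lt_trans with (1 := HD t ltac:(lra)).
  replace (eps : R) with (K * (eps / K)) by (field; lra).
  apply Rmult_lt_compat_l; [exact HK|].
  rewrite <- (exp_ln (eps / K)).
  - apply exp_increasing. lra.
  - apply Rdiv_lt_0_compat; [apply cond_pos|exact HK].
Qed.

(** Integration by parts: the derivative of [t^x exp(-t)] has improper integral [0 - 0], both
    boundary limits being zero. *)
Lemma Gamma_S (x : R) : 0 < x -> Gamma (x + 1) = x * Gamma x.
Proof.
  intros Hx. destruct (Gamma_correct x Hx) as [_ HI].
  (* Eventually the whole interval of integration lies in the positive axis, the only region where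
     the derivative formula is available. *)
  assert (HF : filter_prod (at_right 0) (Rbar_locally p_infty)
    (fun ab : R * R => forall t, Rmin (fst ab) (snd ab) <= t -> 0 < t)).
  { exists (fun a => 0 < a) (fun b => 0 < b).
    - exists (mkposreal 1 Rlt_0_1). intros y _ Hy. exact Hy.
    - now exists 0.
    - intros a b Ha Hb t Ht. apply Rlt_le_trans with (2 := Ht). now apply Rmin_glb_lt. }
  assert (HB : is_RInt_gen (fun t => x * Gamma_integrand x t - Gamma_integrand (x + 1) t)
    (at_right 0) (Rbar_locally p_infty) (0 - 0)).
  { apply (is_RInt_gen_ext (Derive (Gamma_integrand (x + 1)))).
    - revert HF. apply filter_imp. intros ab Hab t Ht.
      apply is_derive_unique, is_derive_Gamma_integrand, Hab. lra.
    - apply is_RInt_gen_Derive.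
      + revert HF. apply filter_imp. intros ab Hab t Ht.
        eexists. apply is_derive_Gamma_integrand, Hab. lra.
      + revert HF. apply filter_imp. intros ab Hab t Ht.
        assert (Ht0 : 0 < t) by (apply Hab; lra).
        apply (continuous_ext_loc _ (fun t => x * Gamma_integrand x t
          - Gamma_integrand (x + 1) t)).
        * exists (mkposreal t Ht0). intros y Hy. symmetry.
          apply is_derive_unique, is_derive_Gamma_integrand.
          change (Rabs (y - t) < t) in Hy. apply Rabs_def2 in Hy. lra.
        * apply (continuous_minus (V := R_NormedModule)).
          -- apply (continuous_scal_r (V := R_NormedModule)).
             now apply continuous_Gamma_integrand.
          -- now apply continuous_Gamma_integrand.
      + now apply Gamma_integrand_lim_0.
      + now apply Gamma_integrand_lim_infty. }
  assert (HS : is_RInt_gen (Gamma_integrand (x + 1)) (at_right 0) (Rbar_locally p_infty)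
    (x * Gamma x - (0 - 0))).
  { generalize (is_RInt_gen_minus _ _ _ _ (is_RInt_gen_scal _ x _ HI) HB).
    apply is_RInt_gen_ext. apply filter_forall. intros ab t _.
    unfold minus, plus, opp, scal; simpl. unfold mult; simpl. ring. }
  replace (x * Gamma x) with (x * Gamma x - (0 - 0)) by ring.
  exact (is_RInt_gen_unique _ _ HS).
Qed.

(** * The radius *)

(** The functional equation is used in numerator and denominator. The resulting factor is at least
    1, giving monotonicity, and tends to 1, giving the radius of convergence. *)
Lemma gamma_ratio_S (alpha : R) (n : nat) :
  0 < alpha < 1 ->
  gamma_ratio alpha (S n) =
  gamma_ratio alpha n * ((INR n + 1) / (INR n + 1 - alpha)).
Proof.
  intros Ha. generalize (pos_INR n); intros. unfold gamma_ratio. rewrite S_INR.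
  rewrite (Gamma_S (INR n + 1)) by lra.
  replace (INR n + 1 + 1 - alpha) with (INR n + 1 - alpha + 1) by ring.
  rewrite (Gamma_S (INR n + 1 - alpha)) by lra.
  destruct (Gamma_correct (INR n + 1 - alpha)) as [HG _]; [lra|].
  field. lra.
Qed.

Lemma gamma_ratio_pos (alpha : R) (n : nat) : 0 < alpha < 1 -> 0 < gamma_ratio alpha n.
Proof.
  intros Ha. generalize (pos_INR n); intros. apply Rdiv_lt_0_compat;
  apply Gamma_correct; lra.
Qed.

Lemma gamma_ratio_1_le (alpha : R) (n : nat) :
  0 < alpha < 1 -> gamma_ratio alpha 1 <= gamma_ratio alpha (S n).
Proof.
  intros Ha. induction n as [|n IH]; [lra|].
  eapply Rle_trans; [exact IH|]. rewrite (gamma_ratio_S alpha (S n) Ha).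
  generalize (gamma_ratio_pos alpha (S n) Ha) (pos_INR (S n)); intros.
  rewrite <- (Rmult_1_r (gamma_ratio alpha (S n))) at 1.
  apply Rmult_le_compat_l; [lra|].
  apply Rmult_le_reg_r with (INR (S n) + 1 - alpha); [lra|]. field_simplify; lra.
Qed.

Lemma CV_radius_gamma_ratio (alpha : R) :
  0 < alpha < 1 -> CV_radius (fun k => gamma_ratio alpha (S k)) = 1.
Proof.
  intros Ha. rewrite <- Rinv_1.
  apply (CV_radius_finite_DAlembert _ 1).
  - intros n. apply Rgt_not_eq, gamma_ratio_pos, Ha.
  - lra.
  - apply (is_lim_seq_ext (fun n => 1 + alpha * / (INR (S (S n)) - alpha))).
    + intros n. rewrite (gamma_ratio_S alpha (S n) Ha).
      generalize (gamma_ratio_pos alpha (S n) Ha) (pos_INR (S n)); intros.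
      rewrite (S_INR (S n)), Rabs_pos_eq.
      * field. lra.
      * left. apply Rdiv_lt_0_compat; [|lra].
        apply Rmult_lt_0_compat; [lra|apply Rdiv_lt_0_compat; lra].
    + replace (Finite 1) with (Finite (1 + alpha * 0)) by (f_equal; ring).
      apply is_lim_seq_plus'; [apply is_lim_seq_const|].
      apply (is_lim_seq_scal_l _ alpha 0).
      apply (is_lim_seq_inv _ p_infty); [|easy].
      apply (is_lim_seq_minus _ _ p_infty alpha p_infty);
        [|apply is_lim_seq_const|easy].
      apply (is_lim_seq_incr_1 (fun n => INR (S n))), (is_lim_seq_incr_1 INR).
      exact is_lim_seq_INR.
Qed.

(* The left-hand side of the radius equation, with r^(1 + alpha) factored out. *)
Definition radius_fun (alpha r : R) : R :=
  Rpower r (1 + alpha) * PSeries (fun k => gamma_ratio alpha (S k)) r.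

(** Used with [s = alpha] for the radius equation and with [s = - alpha] for the series in the
    theorem. *)
Lemma Rpower_INR_S (r s : R) (k : nat) :
  0 < r -> Rpower r (INR (S k) + s) = r ^ k * Rpower r (1 + s).
Proof.
  intros Hr. rewrite <- Rpower_pow, <- Rpower_plus by exact Hr.
  f_equal. rewrite S_INR. ring.
Qed.

Lemma is_series_gamma_ratio (alpha r : R) :
  0 < alpha < 1 -> 0 < r < 1 ->
  is_series (fun k => gamma_ratio alpha (S k) * r ^ k)
    (PSeries (fun k => gamma_ratio alpha (S k)) r).
Proof.
  intros Ha Hr. apply is_pseries_R, PSeries_correct, CV_radius_inside.
  rewrite CV_radius_gamma_ratio by exact Ha. simpl. rewrite Rabs_pos_eq; lra.
Qed.

Lemma solves_radius_eq_iff (alpha r : R) :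
  0 < alpha < 1 -> 0 < r < 1 ->
  solves_radius_eq alpha r <-> radius_fun alpha r = 1 / Gamma (1 - alpha) ^ 2.
Proof.
  intros Ha Hr.
  assert (H : is_series
    (fun k => gamma_ratio alpha (S k) * Rpower r (INR (S k) + alpha))
    (radius_fun alpha r)).
  { generalize (is_series_scal_l (Rpower r (1 + alpha)) _ _
      (is_series_gamma_ratio alpha r Ha Hr)).
    apply is_series_ext. intros k. rewrite Rpower_INR_S by lra.
    unfold scal; simpl. unfold mult; simpl. ring. }
  unfold solves_radius_eq. split.
  - intros H1. rewrite <- (is_series_unique _ _ H1). symmetry.
    now apply is_series_unique.
  - now intros <-.
Qed.

(** Comparison with the geometric series whose coefficients all equal the first ratio; it forces
    blow-up as [r] tends to 1. *)
Lemma PSeries_gamma_ratio_ge (alpha r : R) :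
  0 < alpha < 1 -> 0 < r < 1 ->
  gamma_ratio alpha 1 / (1 - r) <= PSeries (fun k => gamma_ratio alpha (S k)) r.
Proof.
  intros Ha Hr.
  assert (Hg : is_series (fun k => gamma_ratio alpha 1 * r ^ k) (gamma_ratio alpha 1 / (1 - r))).
  { apply (is_series_scal_l (gamma_ratio alpha 1) (fun k => r ^ k) (/ (1 - r))).
    apply is_series_geom. rewrite Rabs_pos_eq; lra. }
  rewrite <- (is_series_unique _ _ Hg),
    <- (is_series_unique _ _ (is_series_gamma_ratio alpha r Ha Hr)).
  apply Series_le; [|eexists; now apply is_series_gamma_ratio].
  intros k. generalize (gamma_ratio_pos alpha 1 Ha) (gamma_ratio_1_le alpha k Ha)
    (pow_le r k). intros. split; [apply Rmult_le_pos; lra|].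
  apply Rmult_le_compat_r; lra.
Qed.

Lemma PSeries_gamma_ratio_le (alpha r s : R) :
  0 < alpha < 1 -> 0 < r <= s -> s < 1 ->
  PSeries (fun k => gamma_ratio alpha (S k)) r <= PSeries (fun k => gamma_ratio alpha (S k)) s.
Proof.
  intros Ha Hr Hs.
  rewrite <- (is_series_unique _ _ (is_series_gamma_ratio alpha r Ha ltac:(lra))),
    <- (is_series_unique _ _ (is_series_gamma_ratio alpha s Ha ltac:(lra))).
  apply Series_le; [|eexists; apply is_series_gamma_ratio; lra].
  intros k. generalize (gamma_ratio_pos alpha (S k) Ha) (pow_le r k) (pow_incr r s k).
  intros. split; [apply Rmult_le_pos; lra|]. apply Rmult_le_compat_l; lra.
Qed.

Lemma PSeries_gamma_ratio_pos (alpha r : R) :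
  0 < alpha < 1 -> 0 < r < 1 -> 0 < PSeries (fun k => gamma_ratio alpha (S k)) r.
Proof.
  intros Ha Hr. apply Rlt_le_trans with (2 := PSeries_gamma_ratio_ge alpha r Ha Hr).
  apply Rdiv_lt_0_compat; [now apply gamma_ratio_pos|lra].
Qed.

(** Strictness comes from the power factor; the series factor need only be positive and
    nondecreasing. *)
Lemma radius_fun_increasing (alpha r s : R) :
  0 < alpha < 1 -> 0 < r < s -> s < 1 -> radius_fun alpha r < radius_fun alpha s.
Proof.
  intros Ha Hr Hs. unfold radius_fun.
  assert (H1 : Rpower r (1 + alpha) < Rpower s (1 + alpha)).
  { apply exp_increasing, Rmult_lt_compat_l; [lra|]. apply ln_increasing; lra. }
  assert (H2 := PSeries_gamma_ratio_le alpha r s Ha ltac:(lra) Hs).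
  assert (H3 := PSeries_gamma_ratio_pos alpha r Ha ltac:(lra)).
  assert (0 < Rpower r (1 + alpha)) by apply exp_pos.
  apply Rlt_le_trans with (Rpower s (1 + alpha) * PSeries (fun k => gamma_ratio alpha (S k)) r).
  - now apply Rmult_lt_compat_r.
  - apply Rmult_le_compat_l; lra.
Qed.

Lemma radius_fun_continuity (alpha r : R) :
  0 < alpha < 1 -> 0 < r < 1 -> continuity_pt (radius_fun alpha) r.
Proof.
  intros Ha Hr.
  apply (continuity_pt_mult (fun x => Rpower x (1 + alpha)) (PSeries _)).
  - apply continuity_pt_filterlim.
    apply (ex_derive_continuous (fun x => Rpower x (1 + alpha))).
    unfold Rpower. auto_derive. lra.
  - apply PSeries_continuity. rewrite CV_radius_gamma_ratio by exact Ha.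
    simpl. rewrite Rabs_pos_eq; lra.
Qed.

Lemma radius_fun_small (alpha T : R) :
  0 < alpha < 1 -> 0 < T -> exists r, 0 < r <= 1 / 2 /\ radius_fun alpha r < T.
Proof.
  intros Ha HT. set (G := PSeries (fun k => gamma_ratio alpha (S k)) (1 / 2)).
  assert (HG : 0 < G) by (apply PSeries_gamma_ratio_pos; lra).
  (* Since [r^(1 + alpha) <= r] and the series is at most its value [G] at 1/2, the function is at
     most [r G <= T/2]. *)
  set (r := Rmin (1 / 2) (T / (2 * G))).
  assert (Hr : 0 < r <= 1 / 2).
  { unfold r. split; [apply Rmin_glb_lt; [lra|apply Rdiv_lt_0_compat; lra]|apply Rmin_l]. }
  assert (HrG : r * G <= T / 2).
  { replace (T / 2) with (T / (2 * G) * G) by (field; lra).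
    apply Rmult_le_compat_r; [lra|apply Rmin_r]. }
  exists r. split; [exact Hr|]. unfold radius_fun.
  assert (H1 := PSeries_gamma_ratio_le alpha r (1 / 2) Ha ltac:(lra) ltac:(lra)).
  fold G in H1.
  assert (H2 : Rpower r (1 + alpha) <= r).
  { rewrite <- (Rpower_1 r) at 2 by lra. left. apply exp_increasing.
    assert (ln r < 0) by (rewrite <- ln_1; apply ln_increasing; lra). nra. }
  apply Rle_lt_trans with (r * G); [|lra].
  apply Rmult_le_compat; [left; apply exp_pos| |exact H2|exact H1].
  left. apply PSeries_gamma_ratio_pos; lra.
Qed.

Lemma radius_fun_large (alpha T : R) :
  0 < alpha < 1 -> 0 < T -> exists r, 1 / 2 <= r < 1 /\ T < radius_fun alpha r.
Proof.
  intros Ha HT. set (g := gamma_ratio alpha 1).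
  assert (Hg : 0 < g) by now apply gamma_ratio_pos.
  (* At [1 - d >= 1/2] the power factor is at least 1/4, its exponent being below 2, and the series
     is at least [g/d >= 8 T]; the product is at least [2 T]. *)
  set (d := Rmin (1 / 2) (g / (8 * T))).
  assert (Hd : 0 < d <= 1 / 2).
  { unfold d. split; [apply Rmin_glb_lt; [lra|apply Rdiv_lt_0_compat; lra]|apply Rmin_l]. }
  assert (HdT : 8 * T <= g / d).
  { apply Rmult_le_reg_r with d; [lra|].
    replace (g / d * d) with (8 * T * (g / (8 * T))) by (field; lra).
    apply Rmult_le_compat_l; [lra|apply Rmin_r]. }
  exists (1 - d). split; [lra|]. unfold radius_fun.
  assert (H1 := PSeries_gamma_ratio_ge alpha (1 - d) Ha ltac:(lra)).
  replace (1 - (1 - d)) with d in H1 by ring. fold g in H1.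
  assert (H2 : 1 / 4 <= Rpower (1 - d) (1 + alpha)).
  { apply Rle_trans with (Rpower (1 - d) (INR 2)).
    - rewrite Rpower_pow by lra. simpl. nra.
    - left. apply exp_increasing. simpl.
      assert (ln (1 - d) < 0) by (rewrite <- ln_1; apply ln_increasing; lra). nra. }
  apply Rlt_le_trans with (1 / 4 * (8 * T)); [lra|].
  apply Rmult_le_compat; lra.
Qed.

Lemma radius_fun_root (alpha T : R) :
  0 < alpha < 1 -> 0 < T -> exists N, 0 < N < 1 /\ radius_fun alpha N = T.
Proof.
  intros Ha HT.
  destruct (radius_fun_small alpha T Ha HT) as [p [Hp HpT]].
  destruct (radius_fun_large alpha T Ha HT) as [q [Hq HqT]].
  (* Both points may equal 1/2 by their bounds alone; the values on opposite sides of [T] exclude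
     it. *)
  assert (Hpq : p < q).
  { destruct (Rlt_or_le p q) as [|Hle]; [easy|].
    assert (E : p = q) by lra. rewrite E in HpT. lra. }
  destruct (Ranalysis5.IVT_interv (fun r => radius_fun alpha r - T) p q) as [N [HN HNT]];
    try lra.
  - intros r Hr. apply continuity_pt_minus.
    + apply radius_fun_continuity; lra.
    + now apply continuity_pt_const.
  - exists N. split; lra.
Qed.

(** [Series] has a value even for a divergent series, so convergence is asserted together with the
    inequality. *)
Theorem theorem3p4 :
  forall alpha : R, 0 < alpha < 1 ->
  exists N : R, is_min_solution alpha N /\
  forall (f : C -> C) (a : nat -> C),
    class_B f -> power_series_in_disk a f ->
    forall r : R, 0 < r <= N ->
      ex_series (fun k : nat =>
        gamma_ratio alpha (S k) * Cmod (a (S k))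
          * Rpower r (INR (S k) - alpha)) /\
      Cmod (a 0%nat) ^ 2 * (Rpower r (- 2 * alpha) / Gamma (1 - alpha) ^ 2)
        + Series (fun k : nat =>
            gamma_ratio alpha (S k) * Cmod (a (S k))
              * Rpower r (INR (S k) - alpha))
        <= Rpower r (- 2 * alpha) / Gamma (1 - alpha) ^ 2.
Proof.
  intros alpha Ha.
  destruct (Gamma_correct (1 - alpha)) as [HG _]; [lra|].
  set (T := 1 / Gamma (1 - alpha) ^ 2).
  assert (HT : 0 < T) by (apply Rdiv_lt_0_compat; [lra|now apply pow_lt]).
  destruct (radius_fun_root alpha T Ha HT) as [N [HN HNT]].
  exists N. split.
  { split; [split; [exact HN|now apply solves_radius_eq_iff]|].
    (* A solution below [N] would contradict strict monotonicity. *)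
    intros r Hr Hsol. apply solves_radius_eq_iff in Hsol; [|easy|easy]. fold T in Hsol.
    apply Rnot_lt_le. intros Hlt.
    generalize (radius_fun_increasing alpha r N Ha ltac:(lra) ltac:(lra)). lra. }
  intros f a Hf Hfa r Hr.
  set (D := 1 - Cmod (a 0%nat) ^ 2).
  assert (HC : forall k, Cmod (a (S k)) <= D).
  { intros k. apply (class_B_coef_bound f); [easy|easy|lia]. }
  assert (HD : 0 <= D) by (eapply Rle_trans; [apply Cmod_ge_0|apply (HC 0%nat)]).
  (* The factor common to all terms once each [|a_n|] is replaced by its bound [D]. *)
  set (w := D * Rpower r (1 - alpha)).
  assert (Hw : is_series (fun k => w * (gamma_ratio alpha (S k) * r ^ k))
    (w * PSeries (fun k => gamma_ratio alpha (S k)) r)).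
  { exact (is_series_scal_l w _ _ (is_series_gamma_ratio alpha r Ha ltac:(lra))). }
  assert (Hterm : forall k,
    0 <= gamma_ratio alpha (S k) * Cmod (a (S k)) * Rpower r (INR (S k) - alpha)
      <= w * (gamma_ratio alpha (S k) * r ^ k)).
  { intros k. unfold Rminus at 1 2. rewrite Rpower_INR_S by lra.
    assert (0 <= gamma_ratio alpha (S k)) by (left; now apply gamma_ratio_pos).
    assert (0 < Rpower r (1 - alpha)) by apply exp_pos.
    assert (0 <= r ^ k) by (apply pow_le; lra).
    assert (0 <= gamma_ratio alpha (S k) * (r ^ k * Rpower r (1 - alpha)))
      by (apply Rmult_le_pos; [easy|apply Rmult_le_pos; lra]).
    generalize (Cmod_ge_0 (a (S k))) (HC k). unfold w, Rminus in *. nra. }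
  split.
  - apply (ex_series_le (K := R_AbsRing) (V := R_CompleteNormedModule) _
      (fun k => w * (gamma_ratio alpha (S k) * r ^ k))).
    + intros k. generalize (Hterm k). intros [H1 H2].
      unfold norm; simpl. unfold abs; simpl. now rewrite Rabs_pos_eq.
    + eexists. exact Hw.
  - assert (HS := Series_le _ _ Hterm (ex_intro _ _ Hw)).
    rewrite (is_series_unique _ _ Hw) in HS.
    assert (Hrad : radius_fun alpha r <= T).
    { rewrite <- HNT. destruct (proj2 Hr) as [Hlt|Heq]; [|right; now rewrite Heq].
      left. apply radius_fun_increasing; lra. }
    (* Splitting [r^(1 - alpha)] as [r^(-2 alpha) r^(1 + alpha)] makes the radius function appear,
       and it is at most [T] up to [N]. *)
    assert (Hw' : w * PSeries (fun k => gamma_ratio alpha (S k)) r =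
      D * Rpower r (- 2 * alpha) * radius_fun alpha r).
    { unfold w, radius_fun.
      replace (1 - alpha) with (- 2 * alpha + (1 + alpha)) by ring.
      rewrite Rpower_plus. ring. }
    rewrite Hw' in HS.
    assert (D * Rpower r (- 2 * alpha) * radius_fun alpha r
      <= D * Rpower r (- 2 * alpha) * T).
    { apply Rmult_le_compat_l; [|exact Hrad].
      apply Rmult_le_pos; [exact HD|left; apply exp_pos]. }
    replace (Rpower r (- 2 * alpha) / Gamma (1 - alpha) ^ 2) with
      (Rpower r (- 2 * alpha) * T) by (unfold T; field; lra).
    unfold D in *. lra.
Qed.
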